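(* The Polish Algorithm for the law $abc{*}{*} = ab{*}cc{*}{*}$ (that is, $a(bc)=(ab)(cc)$) diverges for the pair of terms $$u_0 = 11111001000,\qquad v_0 = 1101011110000,$$ where $1$ denotes the variable $x$ and $0$ denotes the operation symbol $*$.
   Context: Terms. $\mathbf{T}$ is the set of terms in one variable $x$ and one binary operation symbol $*$ in right Polish notation: it is the smallest set of finite words over the alphabet $\{x,*\}$ with $x \in \mathbf{T}$ and $st* \in \mathbf{T}$ whenever $s,t\in\mathbf{T}$ (the word $st*$ represents the product $s\cdot t$). One writes $1$ for $x$ and $0$ for $*$, e.g. $xx{*}x{*}=11010$. A term $v$ is viewed as a word $v(0)v(1)\cdots v(n-1)$ with $n=\mathrm{length}(v)$. First difference. For $u,v\in\mathbf{T}$, $d(u,v)$ is the least $i<\min(\mathrm{length}(u),\mathrm{length}(v))$ with $u(i)\ne v(i)$ if such an $i$ exists, and $d(u,v)=\infty$ otherwise. Dynamic range. Let $d=d(u,v)<\infty$ and $v(d)=*$ (so $u(d)=x$). Then $u$ and $v$ can be written uniquely as $$u = A\,t_0\,t_1\,t_2 * t_3 * \cdots t_n * *\, B,\qquad v = A\,t_0\,t_1 *\, C,$$ where $n\ge 2$, $t_0,\dots,t_n\in\mathbf{T}$, $A,B,C$ are strings, and the first letter of $t_2$ is at position $d$ in $u$ (so the displayed subterm of $u$ is $t_0\cdot((\cdots((t_1\cdot t_2)\cdot t_3)\cdots)\cdot t_n)$). Polish Algorithm for $abc{*}{*} = ab{*}cc{*}{*}$. Given $(u,v)$, stop if $d(u,v)=\infty$.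 Otherwise let $d=d(u,v)$. If $v(d)=*$, put $v'=v$ and, with the notation above, $$u' = A\,t_0\,t_1 *\, t_2\,t_2 **\, t_3\,t_3 ** \cdots t_n\,t_n **\, B .$$ If $u(d)=*$, put $u'=u$ and define $v'$ analogously with the roles of $u$ and $v$ exchanged. Passing from $(u,v)$ to $(u',v')$ is one step. The algorithm repeats steps; it terminates on $(u,v)$ if after finitely many steps it reaches a pair $(u^*,v^* )$ with $d(u^*,v^* )=\infty$, and diverges otherwise. *)

(* Defs.v *)
From Stdlib Require Import Relation_Operators.
From mathcomp Require Import all_boot.
From mathcomp Require Import zify.

Set Implicit Arguments.
Unset Strict Implicit.
Unset Printing Implicit Defensive.

(* The letter x (written 1) is encoded as true, the letter * (written 0) as
   false. *)
Definition word := seq bool.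

Declare Scope word_scope.
Delimit Scope word_scope with W.
Notation "1" := true (only parsing) : word_scope.
Notation "0" := false (only parsing) : word_scope.
Local Open Scope word_scope.

Inductive term : word -> Prop :=
| term_var : term [:: 1]
| term_mul (s t : word) : term s -> term t -> term (s ++ t ++ [:: 0]).

(* zip truncates to the shorter word; None stands for an infinite value. *)
Definition first_diff (u v : word) : option nat :=
  let z := zip u v in
  let i := find (fun p => p.1 != p.2) z in
  if (i < size z)%N then Some i else None.

(* The list t2 :: ts stands for t_2, ..., t_n (so n >= 2). *)
Definition expand (u v u' : word) : Prop :=
  exists (d : nat) (A t0 t1 t2 : word) (ts : seq word) (B C : word),
    [/\ first_diff u v = Some d /\ nth 1 v d = 0,
        [/\ term t0, term t1 & forall t : word, t \in t2 :: ts -> term t],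
        u = A ++ t0 ++ t1 ++ flatten [seq t ++ [:: 0] | t <- t2 :: ts]
              ++ [:: 0] ++ B
        /\ v = A ++ t0 ++ t1 ++ [:: 0] ++ C,
        size (A ++ t0 ++ t1) = d
      & u' = A ++ t0 ++ t1 ++ [:: 0]
               ++ flatten [seq t ++ t ++ [:: 0; 0] | t <- t2 :: ts] ++ B].

Definition step (p q : word * word) : Prop :=
  (expand p.1 p.2 q.1 /\ q.2 = p.2) \/ (expand p.2 p.1 q.2 /\ q.1 = p.1).

Definition terminates (u v : word) : Prop :=
  exists u' v', clos_refl_trans _ step (u, v) (u', v')
                /\ first_diff u' v' = None.

Definition diverges (u v : word) : Prop := ~ terminates u v.

(* The rest of this file shows that the relation step is, on pairs of terms, a
   well-defined partial function with values in pairs of terms, defined exactly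
   where first_diff is finite; hence divergence means that the run is
   infinite, and never that it gets stuck. *)

(* Number of subterms on the stack after reading w, starting from k. *)
Fixpoint depth (k : nat) (w : word) : option nat :=
  match w with
  | [::] => Some k
  | true :: w' => depth k.+1 w'
  | false :: w' => if k is k'.+2 then depth k'.+1 w' else None
  end.

Lemma depth_cat k w w' :
  depth k (w ++ w') = obind (fun j => depth j w') (depth k w).
Proof. by elim: w k => [|[] w IH] [|[|k]] //=. Qed.

Lemma depth_term t k : term t -> depth k t = Some k.+1.
Proof.
by move=> tt; elim: tt k => // s t' _ IHs _ IHt k; rewrite depth_cat IHs /= depth_cat IHt.
Qed.

Lemma depth_termP t k w : term t -> depth k (t ++ w) = depth k.+1 w.
Proof. by move=> tt; rewrite depth_cat depth_term. Qed.

Lemma depth_stack w n : depth 0 w = Some n ->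
  exists2 ss, w = flatten ss & size ss = n /\ forall t : word, t \in ss -> term t.
Proof.
elim/last_ind: w n => [|w b IH] n; first by case=> <-; exists [::].
rewrite -cats1 depth_cat; case E: (depth 0 w) => [k|] //=.
have [ss -> [szs tss]] := IH _ E.
case: b => /=.
  case=> <-; exists (rcons ss [:: 1]).
    by rewrite flatten_rcons.
  split; first by rewrite size_rcons szs.
  by move=> t; rewrite mem_rcons inE => /orP[/eqP->|/tss//]; constructor.
case: k E szs => [|[|k]] //= E szs [<-].
case/lastP: ss szs tss E => // ss t; case/lastP: ss => // ss s.
rewrite !size_rcons => -[szs] tss E.
exists (rcons ss (s ++ t ++ [:: 0])).
  by rewrite !flatten_rcons -!catA.
split; first by rewrite size_rcons szs.
move=> r; rewrite mem_rcons inE => /orP[/eqP->|rs].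
  by constructor; apply: tss; rewrite !(mem_rcons, inE) eqxx ?orbT.
by apply: tss; rewrite !(mem_rcons, inE) rs !orbT.
Qed.

Lemma termP w : term w <-> depth 0 w = Some 1%N.
Proof.
split=> [|/depth_stack[ss -> [sz tss]]]; first exact: depth_term.
case: ss sz tss => [|t [|]] //= _ tt.
by rewrite cats0; apply: tt; rewrite mem_head.
Qed.

Lemma term_cons t : term t -> exists t', t = 1 :: t'.
Proof. by move/termP; case: t => [|[] t] // _; exists t. Qed.

Lemma depth_pos k w j : depth k w = Some j -> w != [::] -> (0 < j)%N.
Proof.
elim: w k => // b w IH k /= H _; case: w IH H => [|c w] IH.
  by case: b k => [] [|[|k]] //= [<-].
by case: b => [/IH->|] //; case: k => [|[|k]] // /IH->.
Qed.

Lemma term_chain s ts : term s -> (forall t : word, t \in ts -> term t) ->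
  term (s ++ flatten [seq t ++ [:: 0] | t <- ts]).
Proof.
elim: ts s => [|t ts IH] s st tts /=; first by rewrite cats0.
rewrite catA; apply: IH => [|r rts]; last by apply: tts; rewrite inE rts orbT.
by constructor=> //; apply: tts; rewrite inE eqxx.
Qed.

Lemma depth_drop q k m : depth k.+1 q = Some m -> (m <= k)%N ->
  exists ts B, q = flatten [seq t ++ [:: 0] | t <- ts] ++ [:: 0] ++ B
               /\ forall t : word, t \in ts -> term t.
Proof.
have [n] := ubnP (size q); elim: n q k => // n IH [|[] q] k /= szq.
- by case=> <-; rewrite ltnn.
- move=> H mk; have [|ts [B [Eq tts]]] := IH q k.+1 _ H (leqW mk).
    by rewrite ltnS in szq.
  have tt : term ([:: 1] ++ flatten [seq t ++ [:: 0] | t <- ts]).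
    by apply: term_chain => //; constructor.
  have E : 1 :: q = ([:: 1] ++ flatten [seq t ++ [:: 0] | t <- ts]) ++ 0 :: B.
    by rewrite Eq -catA.
  have HB : depth k.+1 B = Some m.
    by rewrite -[LHS]/(depth k.+2 (0 :: B)) -(depth_termP k.+1 _ tt) -E.
  have [|ts' [B' [EB tts']]] := IH B k _ HB mk.
    by have := congr1 size Eq; rewrite !size_cat /=; lia.
  exists (([:: 1] ++ flatten [seq t ++ [:: 0] | t <- ts]) :: ts'), B'.
  split=> [|t]; first by rewrite E EB /= -!catA.
  by rewrite inE => /orP[/eqP->|/tts'].
- by move=> _ _; exists [::], q.
Qed.

Lemma first_diffP u v d : first_diff u v = Some d <->
  exists p b q c, [/\ u = p ++ b :: q, v = p ++ ~~ b :: c & size p = d].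
Proof.
split.
  rewrite /first_diff; elim: u v d => [|a u IH] [|b v] d //=.
  case: (altP (a =P b)) => [<-|ab] /=.
    rewrite ltnS; case: ifP => // H [<-].
    have := IH v (find (fun p => p.1 != p.2) (zip u v)).
    rewrite H => /(_ erefl) [p [b' [q [c [-> -> <-]]]]].
    by exists (a :: p), b', q, c.
  case=> <-; exists [::], a, u, v; split=> //=.
  by congr cons; case: a b ab => [] [].
move=> [p [b [q [c [-> -> <-]]]]]; rewrite /first_diff.
elim: p => [|a p IH] /=; first by case: b.
by rewrite eqxx /= ltnS; case: ifP IH => // _ [->].
Qed.

Lemma first_diffC u v : first_diff u v = first_diff v u.
Proof.
have H x y d : first_diff x y = Some d -> first_diff y x = Some d.
  move/first_diffP=> [p [b [q [c [-> -> <-]]]]]; apply/first_diffP.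
  by exists p, (~~ b), c, q; rewrite negbK.
case E: (first_diff u v) => [d|]; first by rewrite (H _ _ _ E).
by case E': (first_diff v u) => [d|] //; rewrite (H _ _ _ E') in E.
Qed.

Lemma expand_total u v d : term u -> term v -> first_diff u v = Some d ->
  nth 1 v d = 0 -> exists u', expand u v u'.
Proof.
move=> tu tv Huv vd.
have [p [b [q [c [Eu Ev szp]]]]] := (first_diffP u v d).1 Huv.
move: vd; rewrite -szp {1}Ev nth_cat ltnn subnn /=.
case: b Eu Ev => // Eu Ev _.
move/termP: (tv); rewrite Ev depth_cat; case Ep: (depth 0 p) => [[|[|k]]|] //= _.
have [ss Ess [szs tss]] := depth_stack Ep.
case/lastP: ss Ess szs tss => // ss t1; case/lastP: ss => // ss t0.
rewrite !size_rcons !flatten_rcons => Ess [szs] tss.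
have t0t : term t0 by apply: tss; rewrite !(mem_rcons, inE) eqxx !orbT.
have t1t : term t1 by apply: tss; rewrite !(mem_rcons, inE) eqxx.
move/termP: (tu); rewrite Eu depth_cat Ep /= => Hq.
have [|[|t2 ts] [B [Eq tts]]] := @depth_drop (1 :: q) k.+1 1%N Hq => //.
exists (flatten ss ++ t0 ++ t1 ++ [:: 0]
        ++ flatten [seq t ++ t ++ [:: 0; 0] | t <- t2 :: ts] ++ B).
exists d, (flatten ss), t0, t1, t2, ts, B, c; split=> //.
- by rewrite -Eu -{1}[_ ++ _ :: c]Ev Huv -szp nth_cat ltnn subnn.
- by split; rewrite ?Eq Ess -!catA.
- by rewrite -szp Ess -catA.
Qed.

Lemma term_suffix_uniq A A' t t' :
  term t -> term t' -> A ++ t = A' ++ t' -> A = A' /\ t = t'.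
Proof.
have P r s : term s -> term (r ++ s) -> r = [::].
  move=> ts /termP; rewrite depth_cat; case E: (depth 0 r) => [j|] //=.
  rewrite depth_term // => -[j0]; apply/eqP; apply: contraTT isT => rn.
  by have := depth_pos E rn; rewrite j0.
wlog le : A A' t t' / (size A <= size A')%N.
  move=> W tt tt' E; case: (leqP (size A) (size A')) => [|/ltnW] le; first exact: W.
  by have [] := W _ _ _ _ le tt' tt (esym E).
move=> tt tt' E.
have EA : A = take (size A) A'.
  by have := congr1 (take (size A)) E; rewrite take_size_cat // takel_cat.
have Et : t = drop (size A) A' ++ t'.
  have := congr1 (drop (size A)) E; rewrite drop_size_cat // drop_cat.
  move: le; rewrite leq_eqVlt => /orP[/eqP->|->] //.
  by rewrite ltnn subnn drop0 drop_size.
have r0 : drop (size A) A' = [::] by apply: P tt' _; rewrite -Et.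
by split; [rewrite EA -[RHS](cat_take_drop (size A)) r0 cats0 | rewrite Et r0].
Qed.

Lemma term_star_uniq t t' w w' :
  term t -> term t' -> t ++ 0 :: w = t' ++ 0 :: w' -> t = t' /\ w = w'.
Proof.
wlog le : t t' w w' / (size t <= size t')%N.
  move=> W tt tt' E; case: (leqP (size t) (size t')) => [|/ltnW] le; first exact: W.
  by have [] := W _ _ _ _ le tt' tt (esym E).
move=> tt tt' E.
have Et' : t' = t ++ drop (size t) t'.
  rewrite -{1}(cat_take_drop (size t) t'); congr cat.
  by have := congr1 (take (size t)) E; rewrite take_size_cat // takel_cat.
move: E; rewrite {1}Et' -catA => /eqP; rewrite eqseq_cat // eqxx /= => /eqP.
case: (drop (size t) t') Et' => [|b r] Et' /=.
  by case=> ->; rewrite Et' cats0.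
case=> b0 _; move/termP: tt'; rewrite Et' -b0 depth_termP //.
Qed.

Lemma chain_uniq ts ts' B B' :
  (forall t : word, t \in ts -> term t) -> (forall t : word, t \in ts' -> term t) ->
  flatten [seq t ++ [:: 0] | t <- ts] ++ [:: 0] ++ B
  = flatten [seq t ++ [:: 0] | t <- ts'] ++ [:: 0] ++ B' ->
  ts = ts' /\ B = B'.
Proof.
elim: ts ts' => [|t ts IH] [|t' ts'] tts tts' /=.
- by case.
- by have [r ->] := term_cons (tts' t' (mem_head _ _)).
- by have [r ->] := term_cons (tts t (mem_head _ _)).
rewrite -!catA /= => E.
have [-> E'] := term_star_uniq (tts t (mem_head _ _)) (tts' t' (mem_head _ _)) E.
have [||-> ->] // := IH ts' _ _ E' => r rs.
  by apply: tts; rewrite inE rs orbT.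
by apply: tts'; rewrite inE rs orbT.
Qed.

Lemma expand_functional u v u1 u2 : expand u v u1 -> expand u v u2 -> u1 = u2.
Proof.
move=> [d [A [t0 [t1 [t2 [ts [B [C [[Hd _] [tt0 tt1 tts] [Eu _] sz ->]]]]]]]]].
move=> [d' [A' [t0' [t1' [t2' [ts' [B' [C' H]]]]]]]].
case: H => -[Hd' _] [tt0' tt1' tts'] [Eu' _] sz' ->.
have dd : d = d' by move: Hd'; rewrite Hd => -[].
move: Eu'; rewrite Eu => /eqP.
have assoc (x y z w : word) : x ++ y ++ z ++ w = (x ++ y ++ z) ++ w.
  by rewrite -!catA.
rewrite (assoc A) (assoc A') eqseq_cat ?sz ?sz' // => /andP[/eqP E1 /eqP E2].
have [E0 ->] : A ++ t0 = A' ++ t0' /\ t1 = t1'.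
  by apply: term_suffix_uniq => //; rewrite -!catA.
have [-> ->] := term_suffix_uniq tt0 tt0' E0.
by have [[-> ->] ->] := chain_uniq tts tts' E2.
Qed.

Lemma expand_term u v u' : term u -> expand u v u' -> term u'.
Proof.
move=> tu [d [A [t0 [t1 [t2 [ts [B [C [_ [tt0 tt1 tts] [Eu _] _ ->]]]]]]]]].
move/termP: tu; rewrite Eu => H; apply/termP; rewrite -H.
rewrite !(depth_cat 0 A); case: (depth 0 A) => //= k.
rewrite !(depth_termP _ _ tt0) !(depth_termP _ _ tt1).
have E1 (ss : seq word) j w : (forall t : word, t \in ss -> term t) ->
    depth j.+1 (flatten [seq t ++ [:: 0] | t <- ss] ++ w) = depth j.+1 w.
  elim: ss j => //= t ss IH j tss.
  have tt : term t by apply: tss; rewrite mem_head.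
  rewrite -!catA depth_termP //=.
  by apply: IH => r rs; apply: tss; rewrite inE rs orbT.
have E2 (ss : seq word) j w : (forall t : word, t \in ss -> term t) ->
    depth j.+1 (flatten [seq t ++ t ++ [:: 0; 0] | t <- ss] ++ w) = depth j.+1 w.
  elim: ss j => //= t ss IH j tss.
  have tt : term t by apply: tss; rewrite mem_head.
  rewrite -!catA !(depth_termP _ _ tt) /=.
  by apply: IH => r rs; apply: tss; rewrite inE rs orbT.
by rewrite (E1 _ k.+1 _ tts) /= -(E2 _ k B tts).
Qed.

Lemma step_total u v : term u -> term v -> first_diff u v <> None ->
  exists q, step (u, v) q.
Proof.
move=> tu tv; case E: (first_diff u v) => [d|] // _.
have [p [b [q [c [Eu Ev szp]]]]] := (first_diffP u v d).1 E.
case: b Eu Ev => Eu Ev.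
  have [|u' H] := expand_total tu tv E; last by exists (u', v); left.
  by rewrite Ev -szp nth_cat ltnn subnn.
rewrite first_diffC in E.
have [|v' H] := expand_total tv tu E; last by exists (u, v'); right.
by rewrite Eu -szp nth_cat ltnn subnn.
Qed.

Lemma expand_letters u v u' : expand u v u' ->
  exists2 d, first_diff u v = Some d & nth 1 v d = 0 /\ nth 0 u d = 1.
Proof.
move=> [d [A [t0 [t1 [t2 [ts [B [C [[Hd Hv] [_ _ tts] [Eu _] sz _]]]]]]]]].
exists d => //; split=> //; rewrite Eu.
have [r ->] := term_cons (tts t2 (mem_head _ _)).
have -> (w : word) : A ++ t0 ++ t1 ++ w = (A ++ t0 ++ t1) ++ w by rewrite -!catA.
by rewrite nth_cat sz ltnn subnn.
Qed.

Lemma step_defined p q : step p q -> first_diff p.1 p.2 <> None.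
Proof.
by case=> -[/expand_letters[d H _] _]; [|rewrite first_diffC]; rewrite H.
Qed.

Lemma step_functional p q q' : step p q -> step p q' -> q = q'.
Proof.
have excl u v u' v' : expand u v u' -> expand v u v' -> False.
  move=> /expand_letters[d H [v0 u1]] /expand_letters[d']; rewrite first_diffC H.
  case=> <- [u0 _]; case: (ltnP d (size u)) => du.
    by rewrite (set_nth_default 1) // u0 in u1.
  by rewrite nth_default in u1.
case: p q q' => u v [u1 v1] [u2 v2] [] /= [E1 ->] [] /= [E2 ->].
- by rewrite (expand_functional E1 E2).
- by case: (excl _ _ _ _ E1 E2).
- by case: (excl _ _ _ _ E1 E2).
- by rewrite (expand_functional E1 E2).
Qed.

Lemma step_term p q : step p q -> term p.1 -> term p.2 -> term q.1 /\ term q.2.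
Proof.
by case=> -[E ->] t1 t2; split=> //; apply: expand_term E.
Qed.

Lemma start_terms :
  term [:: 1; 1; 1; 1; 1; 0; 0; 1; 0; 0; 0]
  /\ term [:: 1; 1; 0; 1; 0; 1; 1; 1; 1; 0; 0; 0; 0].
Proof. by split; apply/termP. Qed.

(* Main.v *)
Require Import Defs.
From Stdlib Require Import Relation_Operators Operators_Properties.
From mathcomp Require Import all_boot.

(* After five steps the run reaches a pair
     u = T 1100 11100 10 1110010 00,   v = T 110 1100 1101100 00
   with T a term, and from every such pair three more steps lead to the pair of
   the same form for the longer term T 1100 1101100 0.  Since a step is
   determined by the pair it starts from, the algorithm never stops. *)

Local Open Scope word_scope.

(** Since [step] is functional, every run from a pair in [P] stays in [P]. Its last pair then still
    admits a step, so its first difference is finite. *)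
Lemma invariant_diverges (P : word * word -> Prop) u v :
  (forall p, P p -> exists2 q, step p q & P q) -> P (u, v) -> diverges u v.
Proof.
move=> stepP Puv [u' [v' [/clos_rt_rt1n_iff run]]].
suff: P (u', v') by case/stepP=> q /step_defined.
elim: run Puv => // p q r pq _ IH /stepP[q' pq' Pq'].
by apply: IH; rewrite (step_functional pq pq').
Qed.

(** By functionality a nonempty run from [(u, v)] passes through [(u', v')]; the empty run cannot
    stop, as a pair that has a step has a finite first difference. *)
Lemma step_diverges u v u' v' :
  step (u, v) (u', v') -> diverges u' v' -> diverges u v.
Proof.
move=> uv_step div [u1 [v1 [/clos_rt_rt1n_iff run stop]]].
case E: _ / run => [|q r uv_q q_run].
  by case: E stop => -> -> /(step_defined uv_step).
apply: div; exists u1, v1; split=> //; apply/clos_rt_rt1n_iff.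
by rewrite (step_functional uv_step uv_q) E.
Qed.

(** A boolean test, so that term conditions on explicit words hold by computation. *)
Definition is_term (w : word) : bool := depth 0 w == Some 1%N.

Lemma is_termP w : reflect (term w) (is_term w).
Proof. by apply: (iffP eqP) => /termP. Qed.

Lemma expand_at A t0 t1 t2 ts B C :
  [&& is_term t0, is_term t1 & all is_term (t2 :: ts)] ->
  expand (A ++ t0 ++ t1 ++ flatten [seq t ++ [:: 0] | t <- t2 :: ts]
            ++ [:: 0] ++ B)
         (A ++ t0 ++ t1 ++ [:: 0] ++ C)
         (A ++ t0 ++ t1 ++ [:: 0]
            ++ flatten [seq t ++ t ++ [:: 0; 0] | t <- t2 :: ts] ++ B).
Proof.
move=> /and3P[/is_termP tt0 /is_termP tt1 all_ts].
have tts t : t \in t2 :: ts -> term t by move/(allP all_ts)/is_termP.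
exists (size (A ++ t0 ++ t1)), A, t0, t1, t2, ts, B, C; split=> //.
(* [t2] begins with [x] where the other word has [*], so the words first differ right after
   [A ++ t0 ++ t1]. *)
have [r ->] := term_cons (tts t2 (mem_head _ _)).
split; last by rewrite (catA t0) (catA A) nth_cat ltnn subnn.
apply/first_diffP; exists (A ++ t0 ++ t1), 1.
by do 2 eexists; split; rewrite //= -!catA.
Qed.

Lemma step_left A t0 t1 t2 ts B C :
  [&& is_term t0, is_term t1 & all is_term (t2 :: ts)] ->
  let p := A ++ t0 ++ t1 in
  let v := p ++ [:: 0] ++ C in
  step (p ++ flatten [seq t ++ [:: 0] | t <- t2 :: ts] ++ [:: 0] ++ B, v)
       (p ++ [:: 0] ++ flatten [seq t ++ t ++ [:: 0; 0] | t <- t2 :: ts] ++ B, v).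
Proof.
move=> tts; left; split=> //=; have := @expand_at A t0 t1 t2 ts B C tts.
by rewrite -!catA.
Qed.

Lemma step_right A t0 t1 t2 ts B C :
  [&& is_term t0, is_term t1 & all is_term (t2 :: ts)] ->
  let p := A ++ t0 ++ t1 in
  let u := p ++ [:: 0] ++ C in
  step (u, p ++ flatten [seq t ++ [:: 0] | t <- t2 :: ts] ++ [:: 0] ++ B)
       (u, p ++ [:: 0] ++ flatten [seq t ++ t ++ [:: 0; 0] | t <- t2 :: ts] ++ B).
Proof.
move=> tts; right; split=> //=; have := @expand_at A t0 t1 t2 ts B C tts.
by rewrite -!catA.
Qed.

(** As products, with b = (xx)(xx) and c = (x(xx))x, the pair is (T·xx)·(c·c) and T·(b·b). *)
Definition loop_pair (T : word) : word * word :=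
  (T ++ [:: 1; 1; 0; 0; 1; 1; 1; 0; 0; 1; 0; 1; 1; 1; 0; 0; 1; 0; 0; 0],
   T ++ [:: 1; 1; 0; 1; 1; 0; 0; 1; 1; 0; 1; 1; 0; 0; 0; 0]).

Definition loop_pair1 (T : word) : word * word :=
  (T ++ [:: 1; 1; 0; 0; 1; 1; 1; 0; 0; 1; 0; 1; 1; 1; 0; 0; 1; 0; 0; 0],
   T ++ [:: 1; 1; 0; 0; 1; 1; 0; 1; 1; 0; 0; 0; 1; 1; 0; 1; 1; 0; 0;
            1; 1; 0; 1; 1; 0; 0; 0; 0]).

Definition loop_pair2 (T : word) : word * word :=
  (T ++ [:: 1; 1; 0; 0; 1; 1; 0; 1; 1; 0; 0; 1; 0; 1; 1; 1; 0; 0; 1; 0; 0; 0],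
   T ++ [:: 1; 1; 0; 0; 1; 1; 0; 1; 1; 0; 0; 0; 1; 1; 0; 1; 1; 0; 0;
            1; 1; 0; 1; 1; 0; 0; 0; 0]).

(** This is the product (T·xx)·b. *)
Definition loop_next (T : word) : word :=
  T ++ [:: 1; 1; 0; 0; 1; 1; 0; 1; 1; 0; 0; 0].

Lemma is_term_loop_next T : is_term T -> is_term (loop_next T).
Proof. by move/is_termP=> tT; rewrite /is_term depth_termP. Qed.

(** Expanding T·((xx·xx)·b) gives ((T·xx)·b)·(b·b): the second word already has its form for
    [loop_next T]. *)
Lemma step_loop_pair T : is_term T -> step (loop_pair T) (loop_pair1 T).
Proof.
move=> tT; have := @step_right [::] T [:: 1; 1; 0] [:: 1; 1; 0]
  [:: [:: 1; 1; 0; 1; 1; 0; 0]] [::]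
  [:: 1; 1; 1; 0; 0; 1; 0; 1; 1; 1; 0; 0; 1; 0; 0; 0].
by rewrite /= tT -!catA => /(_ isT).
Qed.

(** Inside the first c, x(xx) becomes (xx)(xx) = b, so that the first word is now
    (T·xx)·((b·x)·c). *)
Lemma step_loop_pair1 T : step (loop_pair1 T) (loop_pair2 T).
Proof.
have := @step_left (T ++ [:: 1; 1; 0; 0]) [:: 1] [:: 1] [:: 1] [::]
  [:: 1; 0; 1; 1; 1; 0; 0; 1; 0; 0; 0]
  [:: 1; 1; 0; 0; 0; 1; 1; 0; 1; 1; 0; 0; 1; 1; 0; 1; 1; 0; 0; 0; 0].
by rewrite /= -!catA => /(_ isT).
Qed.

(** Expanding (T·xx)·((b·x)·c) gives (((T·xx)·b)·xx)·(c·c), which restores the form of the first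
    word. *)
Lemma step_loop_pair2 T :
  is_term T -> step (loop_pair2 T) (loop_pair (loop_next T)).
Proof.
move=> tT; have := @step_left [::] (T ++ [:: 1; 1; 0; 0])
  [:: 1; 1; 0; 1; 1; 0; 0] [:: 1] [:: [:: 1; 1; 1; 0; 0; 1; 0]] [::]
  [:: 1; 1; 0; 1; 1; 0; 0; 1; 1; 0; 1; 1; 0; 0; 0; 0].
rewrite /loop_pair /loop_next /= -!catA; apply.
by rewrite /is_term depth_termP //; apply/is_termP.
Qed.

Lemma loop_pair_diverges T :
  is_term T -> diverges (loop_pair T).1 (loop_pair T).2.
Proof.
(* The invariant has to be closed under single steps, hence it includes the two intermediate
   pairs. *)
move=> tT; pose P p := exists2 S, is_term S &
  [\/ p = loop_pair S, p = loop_pair1 S | p = loop_pair2 S].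
apply: (@invariant_diverges P); last by exists T => //; apply: Or31.
move=> _ [S tS [] ->].
- exists (loop_pair1 S); first exact: step_loop_pair.
  by exists S => //; apply: Or32.
- exists (loop_pair2 S); first exact: step_loop_pair1.
  by exists S => //; apply: Or33.
- exists (loop_pair (loop_next S)); first exact: step_loop_pair2.
  by exists (loop_next S); [apply: is_term_loop_next | apply: Or31].
Qed.

Theorem theorem5 :
  diverges [:: 1; 1; 1; 1; 1; 0; 0; 1; 0; 0; 0]%W
           [:: 1; 1; 0; 1; 0; 1; 1; 1; 1; 0; 0; 0; 0]%W.
Proof.
apply: step_diverges (@step_left [::] [:: 1] [:: 1] [:: 1; 1; 1; 0; 0; 1; 0]
  [::] [::] [:: 1; 0; 1; 1; 1; 1; 0; 0; 0; 0] isT) _ => /=.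
apply: step_diverges (@step_left [::] [:: 1; 1; 0] [:: 1] [:: 1; 1; 0] [:: [::
  1]; [:: 1; 1; 1; 0; 0; 1; 0]] [::] [:: 1; 1; 1; 1; 0; 0; 0; 0] isT) _ => /=.
(* The first word is now (T·xx)·(c·c) with T = ((xx)x)·b; the next three steps turn the second word
   into T·(b·b). *)
apply: step_diverges (@step_right [:: 1; 1; 0; 1; 0] [:: 1] [:: 1] [:: 1; 1;
  0] [::] [:: 0] [:: 1; 1; 0; 0; 0; 1; 1; 0; 0; 1; 1; 1; 0; 0; 1; 0; 1; 1; 1; 0;
  0; 1; 0; 0; 0] isT) _ => /=.
apply: step_diverges (@step_right [:: 1; 1; 0; 1; 0] [:: 1; 1; 0] [:: 1; 1; 0]
  [:: 1; 1; 0] [::] [:: 0] [:: 0; 1; 1; 0; 0; 1; 1; 1; 0; 0; 1; 0; 1; 1; 1; 0;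
  0; 1; 0; 0; 0] isT) _ => /=.
apply: step_diverges (@step_right [::] [:: 1; 1; 0; 1; 0] [:: 1; 1; 0; 1; 1;
  0; 0] [:: 1; 1; 0; 1; 1; 0; 0] [::] [::] [:: 1; 1; 0; 0; 1; 1; 1; 0; 0; 1; 0;
  1; 1; 1; 0; 0; 1; 0; 0; 0] isT) _ => /=.
exact: (@loop_pair_diverges [:: 1; 1; 0; 1; 0; 1; 1; 0; 1; 1; 0; 0; 0]).
Qed.
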